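(* Let $n\ge 2$ and $d\ge 2$ be integers. (a) If $n\ge 2$ and $d\ge 3$, then the $d$-uple (Veronese) embedding of $\mathbb{P}^n$ fails property $\mathbf{N}_{3d-2}$. (b) If $n\ge 3$, then the $2$-uple (Veronese) embedding of $\mathbb{P}^n$ fails property $\mathbf{N}_6$.
   Context: $k$ is an algebraically closed field. For $p\ge1$, a nondegenerate closed subscheme $X\subset\mathbb{P}^N=\operatorname{Proj}S$, $S=k[x_0,\dots,x_N]$, with saturated homogeneous ideal $I_X$, satisfies $\mathbf{N}_{2,p}$ if $\operatorname{Tor}_i^S(I_X,k)$ is concentrated in degrees $\le i+2$ for all $0\le i\le p-1$ (i.e. $I_X$ is generated by quadrics and its minimal free resolution is linear for the first $p$ steps). $X$ satisfies property $\mathbf{N}_p$ (of Green and Lazarsfeld) if it is projectively normal (property $\mathbf{N}_0$) and satisfies $\mathbf{N}_{2,p}$. The $d$-uple embedding of $\mathbb{P}^n$ is the embedding by the complete linear system $|\mathcal{O}_{\mathbb{P}^n}(d)|$; saying that an embedding fails $\mathbf{N}_p$ means its image does not satisfy $\mathbf{N}_p$. *)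

(* Defs.v *)
From mathcomp Require Import all_boot all_order all_algebra.
From mathcomp Require Import mpoly.

Set Implicit Arguments.
Unset Strict Implicit.
Unset Printing Implicit Defensive.

Import Order.TTheory GRing.Theory Num.Theory.
Local Open Scope ring_scope.

(* The polynomial ring S is {mpoly k[r]}, so the ambient projective space has
   dimension r - 1.  A point of it is given by a nonzero coordinate vector
   'I_r -> k, and a closed subscheme by its saturated homogeneous ideal,
   a predicate on S. *)

Definition nonzero_vec (k : fieldType) (r : nat) (x : 'I_r -> k) : Prop :=
  exists i, x i != 0.

(* A polynomial belongs to the homogeneous ideal of X iff each of its
   homogeneous components vanishes on X; the choice of the coordinate vector
   representing a point is therefore irrelevant. *)
Definition vanishing_ideal (k : fieldType) (r : nat)
    (X : ('I_r -> k) -> Prop) (f : {mpoly k[r]}) : Prop :=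
  forall (e : nat) (x : 'I_r -> k), X x -> (pihomog mdeg e f).@[x] = 0.

(* S/I is an integrally closed domain.  The fraction a/b of S/I is integral
   iff a monic equation for it, multiplied by b^m, holds modulo I. *)
Definition projectively_normal (k : fieldType) (r : nat)
    (I : {mpoly k[r]} -> Prop) : Prop :=
  [/\ ~ I 1,
      forall f g : {mpoly k[r]}, I (f * g) -> I f \/ I g
    & forall a b : {mpoly k[r]}, ~ I b ->
        (exists (m : nat) (c : 'I_m -> {mpoly k[r]}),
           I (a ^+ m + \sum_(j < m) c j * a ^+ j * b ^+ (m - j))) ->
        exists q : {mpoly k[r]}, I (a - q * b)].

(* Graded free modules F_i = \bigoplus_a S(- gdeg i a) of finite rank with maps
   F_{i+1} -> F_i and F_0 -> S; elements of F_i are row vectors, and matrices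
   act on the right. *)
Record free_complex (k : fieldType) (r : nat) := FreeComplex {
  grk : nat -> nat;
  gdeg : forall i, 'I_(grk i) -> int;
  gdiff : forall i, 'M[{mpoly k[r]}]_(grk i.+1, grk i);
  gaug : 'cV[{mpoly k[r]}]_(grk 0) }.

Definition graded_free_resolution (k : fieldType) (r : nat)
    (I : {mpoly k[r]} -> Prop) (F : free_complex k r) : Prop :=
  [/\ (forall (a : 'I_(grk F 0)) (m : 'X_{1..r}),
         m \in msupp (gaug F a 0) -> gdeg a = (mdeg m)%:Z)
    /\ (forall i (b : 'I_(grk F i.+1)) (a : 'I_(grk F i)) (m : 'X_{1..r}),
         m \in msupp (gdiff F i b a) -> gdeg b = gdeg a + (mdeg m)%:Z),
      forall f : {mpoly k[r]},
        I f <-> exists v : 'rV_(grk F 0), f = (v *m gaug F) 0 0,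
      forall v : 'rV_(grk F 0),
        v *m gaug F = 0 <-> exists w : 'rV_(grk F 1), v = w *m gdiff F 0
    & forall i (v : 'rV_(grk F i.+1)),
        v *m gdiff F i = 0 <->
        exists w : 'rV_(grk F i.+2), v = w *m gdiff F i.+1].

(* F (x)_S k, where S acts on k through S -> S/(x_0, ..., x_{r-1}) = k. *)
Definition gdiff_k (k : fieldType) (r : nat) (F : free_complex k r) (i : nat) :
    'M[k]_(grk F i.+1, grk F i) :=
  map_mx (mcoeff 0%MM) (gdiff F i).

Definition in_degree (k : fieldType) (r : nat) (F : free_complex k r)
    (i : nat) (j : int) (v : 'rV[k]_(grk F i)) : Prop :=
  forall a, v 0 a != 0 -> gdeg a = j.

Definition tor_cycle (k : fieldType) (r : nat) (F : free_complex k r)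
    (i : nat) : 'rV[k]_(grk F i) -> Prop :=
  match i with
  | 0 => fun=> True
  | i'.+1 => fun v => v *m gdiff_k F i' = 0
  end.

(* H_i(F (x)_S k)_j = 0, that is Tor_i^S(I, k)_j = 0 when F resolves I. *)
Definition tor_vanishes (k : fieldType) (r : nat) (F : free_complex k r)
    (i : nat) (j : int) : Prop :=
  forall v : 'rV[k]_(grk F i), in_degree j v -> tor_cycle v ->
    exists w : 'rV[k]_(grk F i.+1), in_degree j w /\ v = w *m gdiff_k F i.

(* Tor does not depend on the resolution used to compute it, and a homogeneous
   ideal has a graded free resolution by modules of finite rank. *)
Definition N2p (k : fieldType) (r : nat) (I : {mpoly k[r]} -> Prop)
    (p : nat) : Prop :=
  exists2 F : free_complex k r, graded_free_resolution I F
    & forall i : nat, (i < p)%N ->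
      forall j : int, (i + 2)%:Z < j -> tor_vanishes F i j.

Definition Np (k : fieldType) (r : nat) (I : {mpoly k[r]} -> Prop)
    (p : nat) : Prop :=
  projectively_normal I /\ N2p I p.

(* The monomials of degree d in n + 1 variables, a basis of H^0(P^n, O(d)). *)
Definition dmonom (n d : nat) : finType :=
  {m : 'X_{1..n.+1 < d.+1} | mdeg m == d}.

Definition veronese_map (k : fieldType) (n d : nat) (t : 'I_n.+1 -> k) :
    'I_#|dmonom n d| -> k :=
  fun i => let m : 'X_{1..n.+1} := val (val (enum_val i)) in
           \prod_(j < n.+1) t j ^+ m j.

Definition veronese_image (k : fieldType) (n d : nat)
    (x : 'I_#|dmonom n d| -> k) : Prop :=
  exists2 t : 'I_n.+1 -> k, nonzero_vec t & x =1 @veronese_map k n d t.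

Definition veronese_ideal (k : fieldType) (n d : nat) :
    {mpoly k[#|dmonom n d|]} -> Prop :=
  vanishing_ideal (@veronese_image k n d).
Arguments veronese_ideal : clear implicits.

(* Main.v *)
Require Import Defs.
From HB Require Import structures.
From mathcomp Require Import all_boot all_order all_algebra zify ring.
From mathcomp Require Import mpoly.

Set Implicit Arguments.
Unset Strict Implicit.
Unset Printing Implicit Defensive.

Import Order.TTheory GRing.Theory Num.Theory.

(* Let S be the polynomial ring on the monomials of degree d, R = S/I the
   Veronese ring and G a free resolution of R.  The pure powers t_j^d form a
   regular sequence on R, so G stays exact modulo the corresponding variables.
   Let m be a monomial of degree 2d with all exponents < d; it is nonzero in
   the Artinian reduction of R, and suppose that every degree d divisor
   x_1, ..., x_q of m annihilates it there.  Lift m to c_0 in G_0 = S, and choose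
   c_s in G_s with x_s c_(s-1) = d c_s modulo the pure powers and
   x_1, ..., x_(s-1).  If Tor_q(R)_(q+2) = 0, then c_q is a boundary modulo all
   variables.  Cancelling x_q, ..., x_1 in turn, modulo the variables that are
   not among the x_s, shows that m lies in the ideal of R generated by monomials
   of degree d not dividing m, which is absurd.  So property N_(2,q) fails.

   For d >= 3 take m = t_0^(d-1) t_1^(d-1) t_2^2, with 3d - 2 divisors; for d = 2
   take m = t_0 t_1 t_2 t_3, with 6 divisors.  These are the monomial syzygies
   of Ein, Erman and Lazarsfeld. *)

(** * Killing variables and homogeneous parts of polynomials *)

Section Substitution.
Local Open Scope ring_scope.
Variables (k : fieldType) (r : nat).
Local Notation S := {mpoly k[r]}.
Implicit Types (K : pred 'I_r) (f g : S) (m : 'X_{1..r}).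

(** Reduction modulo variables is an endomorphism of [S], so that all the successive quotients live
    in one ring. *)
Definition kill K : S -> S :=
  mmap (@mpolyC r k) (fun i => if K i then 0 else 'X_i).
Arguments kill : simpl never.
HB.instance Definition _ K := GRing.RMorphism.copy (kill K)
  (mmap (@mpolyC r k) (fun i => if K i then 0 else 'X_i)).

Definition involves K m := [exists i, K i && (m i != 0%N)].

Lemma kill_monomial K m :
  kill K 'X_[m] = if involves K m then 0 else 'X_[m].
Proof.
rewrite /kill /= mmapX /mmap1; case: ifPn => [/existsP[i /andP[Ki mi]]|].
  by rewrite (bigD1 i) //= Ki expr0n (negPf mi) mul0r.
rewrite negb_exists => /forallP Km; rewrite [RHS]mpolyXE_id.
apply: eq_bigr => i _; have := Km i.
by case: (K i) => //=; rewrite negbK => /eqP ->; rewrite !expr0.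
Qed.

Lemma killC K c : kill K c%:MP = c%:MP.
Proof. exact: mmapC. Qed.

Lemma killZ K c f : kill K (c *: f) = c *: kill K f.
Proof. by rewrite -!mul_mpolyC rmorphM /= killC. Qed.

Lemma mcoeff_kill K f m :
  (kill K f)@_m = if involves K m then 0 else f@_m.
Proof.
rewrite [f in LHS]mpolyE rmorph_sum raddf_sum /=.
case: ifPn => Km.
  rewrite big1 // => m' _; rewrite killZ kill_monomial mcoeffZ.
  case: ifPn => Km'; first by rewrite mcoeff0 mulr0.
  rewrite mcoeffX; case: eqP => [mm'|_]; last by rewrite mulr0.
  by rewrite mm' Km in Km'.
rewrite [f in RHS]mpolyE raddf_sum /=; apply: eq_bigr => m' _.
rewrite killZ kill_monomial !mcoeffZ; case: ifPn => Km' //.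
rewrite mcoeff0 mcoeffX; case: eqP => [mm'|_ //].
by rewrite -mm' Km' in Km.
Qed.

Lemma kill_var K x : ~~ K x -> kill K 'X_x = 'X_x.
Proof.
move=> Kx; rewrite kill_monomial ifN //; rewrite negb_exists.
apply/forallP => i; rewrite mnm1E; case: (x =P i) => [<-|_]; last by rewrite andbF.
by rewrite (negPf Kx).
Qed.

Lemma kill_var0 K x : K x -> kill K 'X_x = 0.
Proof.
move=> Kx; rewrite kill_monomial ifT //; apply/existsP; exists x.
by rewrite Kx mnm1E eqxx.
Qed.

Lemma eq_kill K K' f : K =1 K' -> kill K f = kill K' f.
Proof.
move=> eqK; apply/mpolyP => m; rewrite !mcoeff_kill.
by congr (if _ then _ else _); apply: eq_existsb => i; rewrite eqK.
Qed.

Lemma kill_sub K K' f : subpred K K' -> kill K' (kill K f) = kill K' f.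
Proof.
move=> sKK'; apply/mpolyP => m; rewrite !mcoeff_kill.
case: ifPn => // K'm; rewrite ifN //; apply: contra K'm => /existsP[i].
by case/andP=> /sKK' Ki mi; apply/existsP; exists i; rewrite Ki.
Qed.

Lemma kill_all f : kill predT f = (f@_0)%:MP.
Proof.
apply/mpolyP => m; rewrite mcoeff_kill mcoeffC.
case: ifPn => [/existsP[i /= mi]|].
  by case: (m =P 0%MM) mi => [->|_ _]; rewrite ?mnm0E ?mulr0.
rewrite negb_exists => /forallP m0; have -> : m = 0%MM.
  by apply/mnmP => i; have := m0 i; rewrite /= negbK mnm0E => /eqP.
by rewrite eqxx mulr1.
Qed.

(** Exponents are subtracted with truncation, so this is a true quotient only when [x] divides every
    monomial of [f]. *)
Definition var_quotient (x : 'I_r) f : S :=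
  \sum_(m <- msupp f) f@_m *: 'X_[m - U_(x)].

(** A monomial that survives [kill K] but not the killing of [x] as well must contain [x]. *)
Lemma kill_divisible K x f : ~~ K x ->
  kill (predU K (pred1 x)) f = 0 ->
  kill K f = 'X_x * kill K (var_quotient x (kill K f)).
Proof.
move=> Kx f0; set g := kill K f.
have gE : g = 'X_x * var_quotient x g.
  rewrite [LHS]mpolyE /var_quotient mulr_sumr.
  rewrite [LHS]big_seq [RHS]big_seq; apply: eq_bigr => m.
  rewrite mcoeff_msupp -scalerAr -mpolyXD addmC => gm.
  rewrite submK // lep1mP; apply: contraNneq gm => mx.
  have := mcoeff_kill (predU K (pred1 x)) f m; rewrite f0 mcoeff0 /g mcoeff_kill.
  have [//|Km] := boolP (involves K m).
  case: ifPn => [/existsP[i]|_ <- //].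
  case/andP=> /= /orP[Ki|/eqP ->] mi; last by rewrite mx in mi.
  by case/existsP: Km; exists i; rewrite Ki.
by rewrite -[LHS](@kill_sub K K) // -/g {1}gE rmorphM /= kill_var.
Qed.


Definition homogeneous_part (e : int) f : S :=
  if e is Posz e' then pihomog mdeg e' f else 0.

Lemma homogeneous_partX e m :
  homogeneous_part e 'X_[m] = if (mdeg m)%:Z == e then 'X_[m] else 0.
Proof. by case: e => e //=; rewrite pihomogX. Qed.

Lemma homogeneous_part_is_linear e : linear (homogeneous_part e).
Proof.
by case: e => e c f g /=; rewrite ?linearP // scaler0 addr0.
Qed.
HB.instance Definition _ e := GRing.isLinear.Build k S S *:%R
  (homogeneous_part e) (homogeneous_part_is_linear e).

Lemma mcoeff_homogeneous_part e f m :
  (homogeneous_part e f)@_m = if (mdeg m)%:Z == e then f@_m else 0.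
Proof.
rewrite [f in LHS]mpolyE linear_sum raddf_sum /=; case: ifPn => em.
  rewrite [f in RHS]mpolyE raddf_sum /=; apply: eq_bigr => m' _.
  rewrite linearZ /= homogeneous_partX; case: ifPn => // em'.
  rewrite scaler0 mcoeff0 mcoeffZ mcoeffX.
  by case: (m' =P m) em em' => [-> -> //|]; rewrite mulr0.
rewrite big1 // => m' _; rewrite linearZ /= homogeneous_partX.
case: ifPn => em'; last by rewrite scaler0 mcoeff0.
rewrite mcoeffZ mcoeffX.
by case: (m' =P m) em em' => [-> /negP//|]; rewrite mulr0.
Qed.

(** Here [g] is zero or homogeneous of degree [e' - e], like an entry of a graded matrix;
    bilinearity reduces the claim to monomials. *)
Lemma homogeneous_partM e e' f g :
  (forall m, m \in msupp g -> e' = e + (mdeg m)%:Z) ->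
  homogeneous_part e' (f * g) = homogeneous_part e f * g.
Proof.
move=> gE; rewrite [g]mpolyE !mulr_sumr linear_sum /= big_seq [RHS]big_seq.
apply: eq_bigr => m /gE {gE} ->; rewrite -!scalerAr linearZ /=; congr (_ *: _).
rewrite [f]mpolyE linear_sum !mulr_suml linear_sum; apply: eq_bigr => m' _.
rewrite -scalerAl !linearZ /= -scalerAl -mpolyXD !homogeneous_partX mdegD PoszD.
by rewrite (inj_eq (addIr _)); case: ifP; rewrite ?mul0r // mpolyXD.
Qed.

Lemma kill_homogeneous_part K e f :
  kill K (homogeneous_part e f) = homogeneous_part e (kill K f).
Proof.
apply/mpolyP => m; rewrite !(mcoeff_kill, mcoeff_homogeneous_part).
by case: ifP; case: ifP.
Qed.

End Substitution.
Arguments kill {k r} K.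

(** * Complexes of graded free modules modulo variables *)

Section Complex.
Local Open Scope ring_scope.
Variables (k : fieldType) (r : nat).
Local Notation S := {mpoly k[r]}.
Variables (rk : nat -> nat) (gd : forall i, 'I_(rk i) -> int).
Variable dd : forall i, 'M[S]_(rk i.+1, rk i).
Hypothesis dd_comp : forall i, dd i.+1 *m dd i = 0.
Hypothesis dd_homogeneous : forall i b a m,
  m \in msupp (dd i b a) -> gd b = gd a + (mdeg m)%:Z.
Implicit Types (K : pred 'I_r) (x : 'I_r).

Local Notation killv K := (map_mx (@kill k r K)).

(* [kill K] is a retraction of S onto the polynomial ring in the variables
   outside K, so this is exactness of the complex modulo the variables in K, at
   all positions > j. *)
Definition exact_from K j := forall i (v : 'rV_(rk i.+1)), (j <= i)%N ->
  killv K (v *m dd i) = 0 -> exists w, killv K v = killv K (w *m dd i.+1).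

(** That is, [x] is a nonzerodivisor on the cokernel of [dd i] modulo [K]. *)
Definition regular_at K x i := forall v : 'rV[S]_(rk i),
  (exists w, killv K ('X_x *: v) = killv K (w *m dd i)) ->
  exists w, killv K v = killv K (w *m dd i).

Lemma killvZ K x m n (v : 'M[S]_(m, n)) : ~~ K x ->
  killv K ('X_x *: v) = 'X_x *: killv K v.
Proof. by move=> Kx; rewrite map_mxZ /= kill_var. Qed.

Lemma killv_sub K K' m n (v w : 'M[S]_(m, n)) : subpred K K' ->
  killv K v = killv K w -> killv K' v = killv K' w.
Proof.
move=> sKK' /matrixP vw; apply/matrixP => i j; have := vw i j.
by rewrite !mxE -(kill_sub _ sKK') => ->; rewrite kill_sub.
Qed.

Lemma killv_divisible K x m n (v : 'M[S]_(m, n)) : ~~ K x ->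
  killv (predU K (pred1 x)) v = 0 ->
  exists u, killv K v = 'X_x *: killv K u.
Proof.
move=> Kx /matrixP v0; exists (map_mx (var_quotient x \o kill K) v).
apply/matrixP => i j; rewrite !mxE /= -kill_divisible //.
by have := v0 i j; rewrite !mxE.
Qed.

Lemma scaleX_inj x m n (v w : 'M[S]_(m, n)) : 'X_x *: v = 'X_x *: w -> v = w.
Proof.
move=> /matrixP vw; apply/matrixP => i j; have := vw i j.
rewrite !mxE; apply: mulfI; rewrite -msupp_eq0 msuppX //.
Qed.

(** If [x v] is a boundary, then [x] times the image of [v] is zero; a free module has no torsion,
    so [v] is a cycle, hence a boundary. *)
Lemma exact_from_regular K x j i : ~~ K x ->
  exact_from K j -> (j < i)%N -> regular_at K x i.
Proof.
case: i => // i Kx exK ji v [w xvw]; apply: exK => //.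
apply: (@scaleX_inj x); rewrite -killvZ // scalemxAl map_mxM xvw.
by rewrite -map_mxM -mulmxA dd_comp mulmx0 map_mx0 scaler0.
Qed.

(** The image of a cycle [v] modulo [x] has the form [x u]. By regularity [u] is the image of some
    [w], and [v - x w] is a cycle modulo [K] that agrees with [v] modulo [x]. *)
Lemma exact_kill K x j : ~~ K x -> exact_from K j -> regular_at K x j ->
  exact_from (predU K (pred1 x)) j.
Proof.
move=> Kx exK regx i v ji vd0.
have [u vdu] := killv_divisible Kx vd0.
have regxi : regular_at K x i.
  move: ji; rewrite leq_eqVlt => /orP[/eqP <- //|].
  exact: exact_from_regular.
have [|w uw] := regxi u; first by exists v; rewrite killvZ.
have [|w' vw'] := exK i (v - 'X_x *: w) ji.
  by rewrite mulmxBl -scalemxAl map_mxB killvZ // vdu uw subrr.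
exists w'; rewrite -(@killv_sub K _ _ _ _ _ _ vw'); last by move=> y /= ->.
rewrite map_mxB map_mxZ /= kill_var0 ?scale0r ?subr0 //.
by rewrite /= eqxx orbT.
Qed.

(** Giving up one position replaces regularity at [j]; the descent below also climbs one position
    per variable. *)
Lemma exact_kill_shift K x j : ~~ K x -> exact_from K j ->
  exact_from (predU K (pred1 x)) j.+1.
Proof.
move=> Kx exK; apply: exact_kill => // [i v ji|]; first by apply/exK/ltnW.
exact: (exact_from_regular Kx exK).
Qed.

Definition degree_part (e : int) i (v : 'rV[S]_(rk i)) : 'rV[S]_(rk i) :=
  \row_a homogeneous_part (e - gd a) (v 0 a).

Lemma degree_part_d e i (v : 'rV_(rk i.+1)) :
  degree_part e (v *m dd i) = degree_part e v *m dd i.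
Proof.
apply/rowP => a; rewrite !mxE linear_sum; apply: eq_bigr => b _.
rewrite mxE; apply: homogeneous_partM => m /dd_homogeneous ->.
ring.
Qed.

Lemma degree_partX e x i (v : 'rV_(rk i)) :
  degree_part (e + 1) ('X_x *: v) = 'X_x *: degree_part e v.
Proof.
apply/rowP => a; rewrite !mxE mulrC [RHS]mulrC; apply: homogeneous_partM => m.
rewrite msuppX inE => /eqP ->; rewrite mdeg1; ring.
Qed.

Lemma killv_degree_part K e i (v : 'rV_(rk i)) :
  killv K (degree_part e v) = degree_part e (killv K v).
Proof. by apply/rowP => a; rewrite !mxE kill_homogeneous_part. Qed.

Definition fiber_cycle i : 'rV[S]_(rk i) -> Prop :=
  match i with
  | 0 => fun=> True
  | i'.+1 => fun v => killv predT (v *m dd i') = 0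
  end.

(* [D] lists the annihilators of [c]: the first one, x, gives [c1] with
   x c = d c1 modulo K, to which the induction applies modulo K and x.  In the
   conclusion c1 = d w + x u, so x c = x d u, and x cancels. *)
Lemma fiber_boundary_descent (D : seq 'I_r) K j (c : 'rV_(rk j)) (e : int) :
    uniq D -> {in D, forall x, ~~ K x} -> exact_from K j ->
    degree_part e c = c -> fiber_cycle c ->
    {in D, forall x, exists w, killv K ('X_x *: c) = killv K (w *m dd j)} ->
    (forall i, i = (j + size D)%N -> forall c' : 'rV_(rk i),
       degree_part (e + (size D)%:Z) c' = c' -> fiber_cycle c' ->
       exists w, killv predT c' = killv predT (w *m dd i)) ->
  exists w, killv (predC (mem D)) c = killv (predC (mem D)) (w *m dd j).
Proof.
elim: D K j c e => [|x D IHD] K j c e.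
  move=> _ _ _ ce cyc _ /(_ j); rewrite /= addn0 => /(_ erefl c).
  rewrite addr0 => /(_ ce cyc) [w cw]; exists w.
  exact: killv_sub cw.
move=> /= /andP[xD uD] KD exK ce _ annD top.
have Kx : ~~ K x by apply: KD; rewrite mem_head.
have [w0 xcw0] := annD x (mem_head _ _).
(* [w0] need not be homogeneous; the differential preserves degrees, so its part of degree [e + 1]
   serves as well. *)
pose c1 := degree_part (e + 1) w0.
have xc1 : killv K ('X_x *: c) = killv K (c1 *m dd j).
  by rewrite -degree_part_d killv_degree_part -xcw0 -killv_degree_part
             degree_partX ce.
pose K1 := predU K (pred1 x).
have [||||||w c1w] := IHD K1 j.+1 c1 (e + 1) uD.
- move=> y yD; rewrite /= negb_or KD ?inE ?yD ?orbT //=.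
  by apply: contraNneq xD => <-.
- exact: exact_kill_shift.
- apply/rowP => a; apply/mpolyP => m; rewrite !mxE !mcoeff_homogeneous_part.
  by case: ifP => // ->.
- rewrite /= -(@killv_sub K predT _ _ _ _ _ xc1) //.
  by rewrite map_mxZ /= kill_var0 // scale0r.
(* From [y c = d w] and [x c = d c1] modulo [K], the vector [y c1 - x w] is a cycle, hence a
   boundary, and [x w] dies modulo [x]. *)
- move=> y yD; have [|w ycw] := annD y; first by rewrite inE yD orbT.
  have [|w' w'E] := exK j ('X_y *: c1 - 'X_x *: w) (leqnn j).
    rewrite mulmxBl -!scalemxAl map_mxB !map_mxZ -xc1 -ycw !map_mxZ.
    by rewrite scalerA mulrC -scalerA subrr.
  exists w'; rewrite -(@killv_sub K K1 _ _ _ _ _ w'E); last by move=> z /= ->.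
  by rewrite map_mxB [X in _ - X]map_mxZ /= kill_var0 ?scale0r ?subr0 //= eqxx orbT.
- move=> i iE c' c'e; apply: top; first by rewrite iE addnS.
  by rewrite intS addrA.
(* The induction gives [c1 = d w] with [x] killed; [L] keeps [x], so there the difference is a
   multiple of [x]. *)
pose L := predC (mem (x :: D)).
have Lx : ~~ L x by rewrite /L /= mem_head.
have KL : subpred K L.
  by move=> y Ky; apply/negP => /KD; rewrite Ky.
have [|u uE] := @killv_divisible L x _ _ (c1 - w *m dd j.+1) Lx.
  apply/eqP; rewrite map_mxB subr_eq0; apply/eqP.
  apply: killv_sub c1w => y /=; rewrite !inE.
  by case: eqP => [-> _|_ /= ->]; rewrite ?orbT.
exists u; apply: (@scaleX_inj x); rewrite -!killvZ //.
rewrite (killv_sub KL xc1) scalemxAl [RHS]map_mxM killvZ // -uE -map_mxM.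
by rewrite mulmxBl -mulmxA dd_comp mulmx0 subr0.
Qed.

End Complex.

(** * Monomials of the Veronese ring *)

Lemma mnm_split n (mu : 'X_{1..n}) q : (q <= mdeg mu)%N ->
  exists2 m : 'X_{1..n}, (m <= mu)%MM & mdeg m = q.
Proof.
elim: q => [|q IHq] qmu.
  exists 0%MM; last exact: mdeg0.
  by apply/mnm_lepP => i; rewrite mnm0E.
have [m mmu mq] := IHq (ltnW qmu).
have [i mi] : exists i, (m i < mu i)%N.
  apply/existsP; apply: contraTT qmu; rewrite negb_exists -leqNgt.
  move=> /forallP mum; rewrite -mq !mdegE; apply: leq_sum => i _.
  by rewrite leqNgt.
exists (m + U_(i))%MM; last by rewrite mdegD mdeg1 mq addn1.
apply/mnm_lepP => j; rewrite mnmDE mnm1E; case: (i =P j) => [<-|_].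
  by rewrite addn1.
by rewrite addn0; apply: (mnm_lepP mmu).
Qed.

Section Veronese.
Local Open Scope ring_scope.
Variables (k : fieldType) (n d : nat).
Local Notation r := #|dmonom n d|.
Local Notation S := {mpoly k[r]}.

Definition exponent (i : 'I_r) : 'X_{1..n.+1} := val (val (enum_val i)).

Lemma mdeg_exponent i : mdeg (exponent i) = d.
Proof. exact: (eqP (valP (enum_val i))). Qed.

Lemma exponent_inj : injective exponent.
Proof. by move=> i j /val_inj/val_inj/enum_val_inj. Qed.

Lemma exponent_surj m : mdeg m = d -> exists i, exponent i = m.
Proof.
move=> md; have mlt : (mdeg m < d.+1)%N by rewrite md.
have mdE : mdeg (BMultinom mlt) == d by rewrite /= md.
by exists (enum_rank (Sub (BMultinom mlt) mdE)); rewrite /exponent enum_rankK.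
Qed.

Definition total_exponent (b : 'X_{1..r}) : 'X_{1..n.+1} :=
  (\sum_i exponent i *+ b i)%MM.

Lemma total_exponentD b b' :
  total_exponent (b + b') = (total_exponent b + total_exponent b')%MM.
Proof.
rewrite /total_exponent -big_split; apply: eq_bigr => i _.
by apply/mnmP => j; rewrite /= !(mnmDE, mulmnE) mulnDr.
Qed.

Lemma total_exponent1 i : total_exponent U_(i)%MM = exponent i.
Proof.
rewrite /total_exponent (bigD1 i) //= big1 ?addm0 => [|j ji].
  by rewrite mnm1E eqxx.
by rewrite mnm1E eq_sym (negPf ji).
Qed.

Lemma mdeg_total_exponent b : mdeg (total_exponent b) = (d * mdeg b)%N.
Proof.
rewrite mdeg_sum mdegE big_distrr; apply: eq_bigr => i _ /=.
by rewrite mdegMn mdeg_exponent.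
Qed.

Lemma total_exponent_surj q m : mdeg m = (d * q)%N ->
  exists2 b, total_exponent b = m & mdeg b = q.
Proof.
elim: q m => [|q IHq] m mq.
  exists 0%MM; last exact: mdeg0.
  have /eqP -> : m == 0%MM by rewrite -mdeg_eq0 mq muln0.
  by apply/eqP; rewrite -mdeg_eq0 mdeg_total_exponent mdeg0 muln0.
have [|m' m'm m'd] := @mnm_split _ m d; first by rewrite mq leq_pmulr.
have [i iE] := exponent_surj m'd.
have [|b bE bq] := IHq (m - m')%MM.
  have := congr1 mdeg (submK m'm); rewrite mdegD mq m'd mulnS addnC.
  by move/addnI.
exists (U_(i) + b)%MM; last by rewrite mdegD mdeg1 bq.
by rewrite total_exponentD total_exponent1 bE iE addmC submK.
Qed.

Definition veronese_hom : S -> {mpoly k[n.+1]} :=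
  mmap (@mpolyC n.+1 k) (fun i => 'X_[exponent i]).
Arguments veronese_hom : simpl never.
HB.instance Definition _ := GRing.RMorphism.copy veronese_hom
  (mmap (@mpolyC n.+1 k) (fun i : 'I_r => 'X_[exponent i])).

Lemma veronese_homX b : veronese_hom 'X_[b] = 'X_[total_exponent b].
Proof.
rewrite /veronese_hom mmapX /mmap1 -mprodXnE.
by apply: eq_bigr => i _; rewrite mpolyXn.
Qed.

Lemma veronese_homZ c f : veronese_hom (c *: f) = c *: veronese_hom f.
Proof. by rewrite /veronese_hom mmapZ mul_mpolyC. Qed.

Lemma msupp_veronese_hom f m : m \in msupp (veronese_hom f) ->
  exists2 b, b \in msupp f & total_exponent b = m.
Proof.
rewrite mcoeff_msupp [f in veronese_hom f]mpolyE rmorph_sum raddf_sum /=.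
move=> fm; have /hasP[b bf] : has (fun b => total_exponent b == m) (msupp f).
  apply: contraNT fm => /hasPn fm; rewrite big_seq big1 // => b /fm bm.
  by rewrite veronese_homZ veronese_homX mcoeffZ mcoeffX (negPf bm) mulr0.
by move/eqP; exists b.
Qed.

Lemma total_exponent_involves (K : pred 'I_r) b : involves K b ->
  exists2 i, K i & (exponent i <= total_exponent b)%MM.
Proof.
case/existsP => i /andP[Ki bi]; exists i => //.
have ib : (U_(i) <= b)%MM by rewrite lep1mP.
by rewrite -(submK ib) total_exponentD total_exponent1 lem_addl.
Qed.

(** A lift can be made to contain the variable [i]: lift the quotient of [m] by its image and
    multiply back. *)
Lemma monomial_lift (K : pred 'I_r) m q i : mdeg m = (d * q)%N -> K i ->
  (exponent i <= m)%MM ->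
  exists2 b, total_exponent b = m & involves K b.
Proof.
move=> mq Ki im; have dm := congr1 mdeg (submK im).
rewrite mdegD mdeg_exponent mq in dm.
have [|b bE _] := @total_exponent_surj q.-1 (m - exponent i)%MM.
  case: q {mq} dm => [|q]; rewrite ?muln0 ?mulnS.
    by move/eqP; rewrite addn_eq0 => /andP[/eqP -> _].
  by rewrite addnC => /addnI.
exists (b + U_(i))%MM.
  by rewrite total_exponentD total_exponent1 bE submK.
by apply/existsP; exists i; rewrite Ki mnmDE mnm1E eqxx addn1.
Qed.

(* The Veronese ring is spanned by monomials, so its ideals generated by
   monomials of degree [d] are detected by divisibility in the polynomial
   ring. *)
Lemma mem_monomial_ideal (K : pred 'I_r) u :
  (exists2 v, veronese_hom v = 0 & kill K u = kill K v) <->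
  {in msupp (veronese_hom u), forall m, exists2 i, K i & (exponent i <= m)%MM}.
Proof.
split=> [[v v0 uv] m mu|um].
  (* [u - v] has the same image as [u], and each of its monomials involves [K]. *)
  have w0 : kill K (u - v) = 0 by rewrite rmorphB /= uv subrr.
  have uw : veronese_hom u = veronese_hom (u - v) by rewrite rmorphB /= v0 subr0.
  rewrite uw in mu; have [b bw <-] := msupp_veronese_hom mu.
  apply: total_exponent_involves; move: bw; rewrite mcoeff_msupp.
  apply: contraNT => Kb; have := mcoeff_kill K (u - v) b.
  by rewrite w0 mcoeff0 (negPf Kb) => <-.
(* The image of [u] is lifted again, monomial by monomial, with lifts that [kill K] annihilates;
   then [u - w] lies in the kernel. *)
have [w uw w0] : exists2 w, veronese_hom u = veronese_hom w & kill K w = 0.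
  rewrite [veronese_hom u]mpolyE.
  have : {subset msupp (veronese_hom u) <= msupp (veronese_hom u)} by [].
  elim: {1 3}(msupp _) => [|m s IHs] su.
    by exists 0; rewrite ?big_nil ?rmorph0.
  have [|w sw w0] := IHs.
    by move=> m' m's; apply: su; rewrite inE m's orbT.
  have mu := su m (mem_head _ _).
  have [i Ki im] := um m mu; have [b' _ b'm] := msupp_veronese_hom mu.
  have [|b bm Kb] := monomial_lift (q := mdeg b') _ Ki im.
    by rewrite -b'm mdeg_total_exponent.
  exists ((veronese_hom u)@_m *: 'X_[b] + w).
    by rewrite big_cons sw rmorphD /= veronese_homZ veronese_homX bm.
  by rewrite rmorphD /= killZ kill_monomial Kb scaler0 add0r.
exists (u - w); first by rewrite rmorphB /= uw subrr.
by rewrite rmorphB /= w0 subr0.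
Qed.

End Veronese.

(** * The Veronese ideal over an algebraically closed field *)

Section ClosedField.
Local Open Scope ring_scope.
Variable k : closedFieldType.

(** Otherwise [p * 'X + 1] is nonconstant and has a root, although its value is 1 everywhere. *)
Lemma closed_poly_eq0 (p : {poly k}) : (forall x, p.[x] = 0) -> p = 0.
Proof.
move=> p0; apply/eqP/negPn/negP => pn0.
have /closed_rootP[x] : size (p * 'X + 1%:P) != 1%N.
  by rewrite size_MXaddC (negPf pn0) /= eqSS size_poly_eq0.
by rewrite /root !hornerE p0 mul0r add0r oner_eq0.
Qed.

(** Variables are eliminated one by one: after [s] of them, the terms agreeing with [m] in the first
    [s] exponents remain, and at [s = n] only the coefficient of [m]. *)
Lemma closed_mpoly_eq0 n (q : {mpoly k[n]}) : (forall t, q.@[t] = 0) -> q = 0.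
Proof.
move=> q0; apply/mpolyP => m; rewrite mcoeff0.
pose agree s (m' : 'X_{1..n}) := [forall i : 'I_n, (i < s)%N ==> (m' i == m i)].
pose term s (t : 'I_n -> k) m' := q@_m' * \prod_(i < n | (s <= i)%N) t i ^+ m' i.
suff /(_ n (leqnn n) (fun=> 0)) :
    forall s, (s <= n)%N -> forall t,
      \sum_(m' <- msupp q | agree s m') term s t m' = 0.
  rewrite (eq_bigl (pred1 m)) => [|m' /=]; last first.
    apply/forallP/eqP => [mm'|-> i]; last by rewrite eqxx implybT.
    by apply/mnmP => i; have := mm' i; rewrite ltn_ord => /eqP.
  have term_m : term n (fun=> 0) m = q@_m.
    by rewrite /term big1 ?mulr1 // => i; rewrite leqNgt ltn_ord.
  have [mq|] := boolP (m \in msupp q); last by move=> mq _; exact/memN_msupp_eq0.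
  by rewrite -big_filter filter_pred1_uniq ?msupp_uniq // big_seq1 term_m.
elim=> [|s IHs] sn t.
  rewrite -[RHS](q0 t) mevalE; apply: eq_big => [m'|m' _].
    by apply/forallP => i.
  by rewrite /term; congr (_ * _); apply: eq_bigl.
pose i0 := Ordinal sn.
(* With the later variables frozen at [t], this is a polynomial in variable [s]; its coefficient of
   degree [m i0] is the next sum. *)
pose p := \sum_(m' <- msupp q | agree s m') term s.+1 t m' *: 'X^(m' i0).
have /(congr1 (fun p : {poly k} => p`_(m i0))) : p = 0.
  apply: closed_poly_eq0 => z; rewrite
    -[RHS](IHs (ltnW sn) (fun i => if i == i0 then z else t i)).
  rewrite horner_sum; apply: eq_bigr => m' _; rewrite hornerZ hornerXn /term.
  rewrite -mulrA; congr (_ * _); rewrite [RHS](bigD1 i0) //= eqxx mulrC.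
  congr (_ * _); apply: eq_big => [i|i si].
    by rewrite -(inj_eq val_inj) /= ltn_neqAle eq_sym andbC.
  by case: eqP si => [->|//]; rewrite ltnn.
rewrite coef0 coef_sum => pm0; rewrite -[RHS]pm0 big_mkcond [RHS]big_mkcond.
apply: eq_bigr => m' _; rewrite coefZ coefXn.
have -> : agree s.+1 m' = agree s m' && (m' i0 == m i0).
  apply/forallP/andP => [mm'|[/forallP mm' m0] i].
    split; last by have := mm' i0; rewrite /= ltnSn.
    apply/forallP => i; apply/implyP => si.
    by have := mm' i; rewrite (ltnW si : (i < s.+1)%N).
  rewrite ltnS leq_eqVlt; apply/implyP => /orP[/eqP si|si].
    by have -> : i = i0 by apply: val_inj.
  by have := mm' i; rewrite si.
by case: (agree s m') => //=; rewrite eq_sym; case: eqP => _; rewrite ?mulr1 ?mulr0.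
Qed.

Variables n d : nat.
Local Notation r := #|dmonom n d|.

Lemma meval_veronese_map (f : {mpoly k[r]}) t :
  f.@[@veronese_map k n d t] = (veronese_hom f).@[t].
Proof.
rewrite [f]mpolyE [X in _ = X.@[_]]rmorph_sum !rmorph_sum /=; apply: eq_bigr => b _.
rewrite veronese_homZ veronese_homX !mevalZ !mevalX; congr (_ * _).
rewrite (eq_bigr (fun i => \prod_j t j ^+ (exponent i j * b i))); last first.
  by move=> i _; rewrite -prodrXl; apply: eq_bigr => j _; rewrite exprM.
rewrite exchange_big /=; apply: eq_bigr => j _.
rewrite /total_exponent mnm_sumE -expr_sum.
by congr (_ ^+ _); apply: eq_bigr => i _; rewrite mulmnE.
Qed.

(** Degrees are multiplied by [d], and [0 < d] keeps distinct degrees apart. *)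
Lemma veronese_hom_pihomog (f : {mpoly k[r]}) e : (0 < d)%N ->
  veronese_hom (pihomog mdeg e f) = pihomog mdeg (d * e) (veronese_hom f).
Proof.
move=> d0; rewrite [f]mpolyE linear_sum !rmorph_sum /= linear_sum.
apply: eq_bigr => b _; rewrite linearZ /= !veronese_homZ linearZ /=.
congr (_ *: _). rewrite veronese_homX !pihomogX /= mdeg_total_exponent.
by rewrite eqn_pmul2l //; case: ifP; rewrite ?veronese_homX ?rmorph0.
Qed.

Lemma veronese_idealE (f : {mpoly k[r]}) : (0 < d)%N ->
  veronese_ideal k n d f <-> veronese_hom f = 0.
Proof.
move=> d0; split=> [fI|f0 e x [t _ xt]]; last first.
  rewrite (meval_eq _ xt) meval_veronese_map veronese_hom_pihomog // f0.
  by rewrite linear0 meval0.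
have fe0 e : veronese_hom (pihomog mdeg e f) = 0.
  (* Only nonzero [t] give points of the image; the factor ['X_ord0] settles the vectors with zero
     first coordinate, among them [t = 0]. *)
  have X0 : 'X_ord0 != 0 :> {mpoly k[n.+1]} by rewrite -msupp_eq0 msuppX.
  apply: (mulfI X0); rewrite mulr0; apply: closed_mpoly_eq0 => t.
  rewrite mevalM mevalXU; have [->|t0] := eqVneq (t ord0) 0; first by rewrite mul0r.
  rewrite -meval_veronese_map (fI e) ?mulr0 //.
  by exists t => //; exists ord0.
rewrite (@pihomog_partitionE _ _ mdeg _ f (leqnn _)) rmorph_sum big1 // => i _.
exact: fe0.
Qed.

End ClosedField.

(** * The augmented resolution and Tor *)

Section Resolution.
Local Open Scope ring_scope.
Variables (k : fieldType) (r : nat) (I : {mpoly k[r]} -> Prop).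
Variable F : free_complex k r.
Hypothesis resF : graded_free_resolution I F.

(* The complex ... -> F_1 -> F_0 -> S, with S in position 0. *)
Definition augmented_rank i := if i is i'.+1 then grk F i' else 1%N.

Definition augmented_deg i : 'I_(augmented_rank i) -> int :=
  match i with 0 => fun=> 0 | i'.+1 => @gdeg k r F i' end.

Definition augmented_diff i :
    'M[{mpoly k[r]}]_(augmented_rank i.+1, augmented_rank i) :=
  match i with 0 => gaug F | i'.+1 => gdiff F i' end.

Lemma augmented_diff_comp i : augmented_diff i.+1 *m augmented_diff i = 0.
Proof.
have [_ _ exact0 exactS] := resF.
apply/row_matrixP => b; rewrite row0 row_mul rowE.
by case: i b => [|i] b; [apply/exact0 | apply/exactS]; exists (delta_mx 0 b).
Qed.

Lemma augmented_diff_homogeneous i b a m :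
  m \in msupp (augmented_diff i b a) ->
  augmented_deg b = augmented_deg a + (mdeg m)%:Z.
Proof.
have [[homog0 homogS] _ _ _] := resF.
case: i b a => [|i] b a /=; last exact: homogS.
by rewrite ord1 add0r; apply: homog0.
Qed.

Lemma kill0 (f : {mpoly k[r]}) : kill pred0 f = f.
Proof.
by apply/mpolyP => m; rewrite mcoeff_kill ifN //; apply/existsP => -[].
Qed.

(** This covers positions from 1 on; at position 0 the cokernel is [S/I]. *)
Lemma augmented_exact : exact_from augmented_diff pred0 0.
Proof.
have [_ _ exact0 exactS] := resF.
have kv0 m n (v : 'M[{mpoly k[r]}]_(m, n)) : map_mx (kill pred0) v = v.
  by apply/matrixP => i j; rewrite mxE kill0.
move=> i v _; rewrite kv0 => vd.
suff [w ->] : exists w, v = w *m augmented_diff i.+1 by exists w.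
by case: i v vd => [|i] v vd; [apply/exact0 | apply/exactS].
Qed.

Lemma mem_augmentation f :
  I f <-> exists w : 'rV_(augmented_rank 1), f%:M = w *m augmented_diff 0.
Proof.
have [_ I_aug _ _] := resF; rewrite I_aug.
split=> -[w fw]; exists w; first by rewrite fw -mx11_scalar.
by rewrite -fw mxE eqxx.
Qed.

(** Position [q.+1] here is position [q] of [F], and killing all variables leaves the constant
    terms, that is, the complex tensored with [k]. *)
Lemma fiber_boundary_tor q (c : 'rV_(augmented_rank q.+1)) (e : int) :
  tor_vanishes F q e -> degree_part augmented_deg e c = c ->
  fiber_cycle augmented_diff c ->
  exists w, map_mx (kill predT) c =
            map_mx (kill predT) (w *m augmented_diff q.+1).
Proof.
move=> tor0 ce cyc.
have [||w [_ cw]] := tor0 (map_mx (mcoeff 0%MM) c).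
(* A nonzero constant term forces its generator to have degree [e]. *)
- move=> a; rewrite mxE -ce mxE mcoeff_homogeneous_part mdeg0.
  case: ifPn => [|_]; last by rewrite eqxx.
  by rewrite eq_sym subr_eq0 => /eqP ->.
- case: q c ce cyc {tor0} => //= q c _ cyc.
  rewrite /gdiff_k -map_mxM; apply/rowP => a; rewrite !mxE.
  have /rowP/(_ a) := cyc; rewrite !mxE kill_all.
  by move/(congr1 (mcoeff 0%MM)); rewrite mcoeffC eqxx mulr1 mcoeff0.
exists (map_mx (@mpolyC r k) w); apply/rowP => a; rewrite !mxE !kill_all.
have /rowP/(_ a) := cw; rewrite !mxE => ->; congr (_ %:MP).
rewrite raddf_sum; apply: eq_bigr => b _.
by rewrite /= [RHS](rmorphM (mcoeff 0%MM)) /= !mxE mcoeffC eqxx mulr1.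
Qed.

End Resolution.

(** * Monomial syzygies of the Veronese ring *)

Section VeroneseSyzygy.
Local Open Scope ring_scope.
Variables (k : closedFieldType) (n d : nat).
Hypothesis d_gt0 : (0 < d)%N.
Local Notation r := #|dmonom n d|.
Local Notation I := (veronese_ideal k n d).
Local Notation expo := (@exponent n d).

(** The bound [s] lets the variables that map to powers [t_j^d] be killed one at a time. *)
Definition pure_power s (i : 'I_r) :=
  [exists j : 'I_n.+1, (j < s)%N && (expo i == U_(j) *+ d)%MM].

Lemma pure_power_le (j : 'I_n.+1) m : (U_(j) *+ d <= m)%MM = (d <= m j)%N.
Proof.
apply/mnm_lepP/idP => [/(_ j)|dm i]; rewrite mulmnE mnm1E.
  by rewrite eqxx mul1n.
by case: (j =P i) => [<-|_]; rewrite ?mul1n.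
Qed.

Lemma pure_power_divides s m :
  (exists2 i, pure_power s i & (expo i <= m)%MM) <->
  (exists2 j : 'I_n.+1, (j < s)%N & (d <= m j)%N).
Proof.
split=> [[i /existsP[j /andP[js /eqP ->]]]|[j js jm]].
  by rewrite pure_power_le; exists j.
have [i iE] : exists i, expo i = (U_(j) *+ d)%MM.
  by apply: exponent_surj; rewrite mdegMn mdeg1 mul1n.
exists i; last by rewrite iE pure_power_le.
by apply/existsP; exists j; rewrite js iE eqxx.
Qed.

(** The image of the augmentation is the kernel of [veronese_hom], so being a boundary modulo [K] is
    membership in a monomial ideal of the Veronese ring. *)
Lemma boundary0E (F : free_complex k r) (K : pred 'I_r)
    (u : 'rV_(augmented_rank F 0)) : graded_free_resolution I F ->
  (exists w, map_mx (kill K) u = map_mx (kill K) (w *m augmented_diff F 0)) <->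
  {in msupp (veronese_hom (u 0 0)), forall m,
    exists2 i, K i & (expo i <= m)%MM}.
Proof.
move=> resF; rewrite -mem_monomial_ideal; split=> [[w /rowP/(_ 0)]|[f f0 uf]].
  rewrite mxE [RHS]mxE => uw; exists ((w *m augmented_diff F 0) 0 0) => //.
  apply/veronese_idealE => //; apply/(mem_augmentation resF); exists w.
  exact/esym/mx11_scalar.
have /(mem_augmentation resF)[w fw] : I f by apply/veronese_idealE.
by exists w; apply/rowP => a; rewrite -fw [a]ord1 !mxE eqxx.
Qed.

(** Multiplication by [t_s^d] changes only the exponent of [t_s], so it does not affect divisibility
    by the earlier pure powers. *)
Lemma pure_power_regular (F : free_complex k r) s (x : 'I_r) :
    graded_free_resolution I F ->
    (exists2 j : 'I_n.+1, j = s :> nat & expo x = (U_(j) *+ d)%MM) ->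
  regular_at (augmented_diff F) (pure_power s) x 0.
Proof.
move=> resF [j js xE] v.
move=> /(boundary0E _ _ resF) xv; apply/(boundary0E _ _ resF) => m mv.
have /xv/pure_power_divides[i is_ im] :
    (expo x + m)%MM \in msupp (veronese_hom (('X_x *: v) 0 0)).
  rewrite mxE rmorphM /= veronese_homX total_exponent1 mulrC.
  by rewrite mcoeff_msupp mcoeffMX -mcoeff_msupp.
apply/pure_power_divides; exists i => //.
move: im; rewrite xE mnmDE mulmnE mnm1E; case: (j =P i) => // ji.
by rewrite -ji js ltnn in is_.
Qed.

Lemma pure_power_exact (F : free_complex k r) s :
  graded_free_resolution I F -> (s <= n.+1)%N ->
  exact_from (augmented_diff F) (pure_power s) 0.
Proof.
(* Adding a variable yields [pure_power s.+1] only pointwise, so exactness is transported along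
   [=1]. *)
have exact_ext K K' : K =1 K' -> exact_from (augmented_diff F) K 0 ->
    exact_from (augmented_diff F) K' 0.
  move=> KK' exK i v _.
  have kE p q (u : 'M_(p, q)) :
      map_mx (@kill k r K') u = map_mx (@kill k r K) u.
    by apply: eq_map_mx => f; apply: eq_kill => y; rewrite KK'.
  rewrite kE => /exK[//|w vw]; exists w.
  by rewrite !kE.
move=> resF; elim: s => [|s IHs] sn.
  apply: exact_ext (augmented_exact resF) => i.
  by apply/esym/existsP => -[j]; rewrite ltn0.
pose j := Ordinal sn.
have [x xE] : exists x, expo x = (U_(j) *+ d)%MM.
  by apply: exponent_surj; rewrite mdegMn mdeg1 mul1n.
have Kx : ~~ pure_power s x.
  apply/existsP => -[i /andP[is_]]; rewrite xE => /eqP/mnmP/(_ i).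
  rewrite !mulmnE !mnm1E eqxx mul1n; case: (j =P i) => [ji|_ /esym d0].
    by rewrite -ji ltnn in is_.
  by move: d_gt0; rewrite d0.
apply: (@exact_ext (predU (pure_power s) (pred1 x))) => [i|].
  apply/orP/existsP => [[/existsP[j' /andP[js jE]]|/eqP ->]|[j' /andP[]]].
  - by exists j'; rewrite jE andbT ltnS ltnW.
  - by exists j; rewrite xE eqxx ltnSn.
  rewrite ltnS leq_eqVlt => /orP[/eqP js|js] /eqP iE.
    right; apply/eqP/exponent_inj; rewrite iE xE.
    by congr (U_(_) *+ d)%MM; apply: val_inj.
  by left; apply/existsP; exists j'; rewrite js iE eqxx.
apply: exact_kill => //; first exact: (augmented_diff_comp resF).
  exact: IHs (ltnW sn).
by apply: pure_power_regular => //; exists j.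
Qed.

(** The exponent bound keeps [m] nonzero modulo the pure powers; the next hypothesis says that its
    divisors of degree [d] annihilate it there. *)
Lemma veronese_not_N2p p (m : 'X_{1..n.+1}) :
    mdeg m = (d * 2)%N -> (forall j, (m j < d)%N) ->
    (forall e, mdeg e = d -> (e <= m)%MM -> exists j, (d <= e j + m j)%N) ->
    (#|[set i | (expo i <= m)%MM]| <= p)%N ->
  ~ N2p I p.
Proof.
move=> m2 md m_ann Dp [F resF torF].
have [b bm b2] := total_exponent_surj m2.
pose D := enum [set i | (expo i <= m)%MM].
have inD i : (i \in D) = (expo i <= m)%MM by rewrite mem_enum inE.
have sizeD : size D = #|[set i | (expo i <= m)%MM]| by rewrite -cardE.
(* The descent must end past position 0, where [F] begins. *)
have D_gt0 : (0 < size D)%N.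
  have [|e em ed] := @mnm_split _ m d; first by rewrite m2 leq_pmulr.
  have [i iE] := exponent_surj ed.
  by rewrite -has_predT; apply/hasP; exists i; rewrite // inD iE.
pose c : 'rV[{mpoly k[r]}]_(augmented_rank F 0) := const_mx 'X_[b].
have D_pure : {in D, forall i, ~~ pure_power n.+1 i}.
  move=> i; rewrite inD => im; apply/negP => Ki.
  have [|j _] := (pure_power_divides n.+1 m).1; first by exists i.
  by rewrite leqNgt md.
have [|||||w] := @fiber_boundary_descent _ _ _ _ _
    (augmented_diff_comp resF) (@augmented_diff_homogeneous _ _ _ _ resF)
    D (pure_power n.+1) 0 c 2 (enum_uniq _) D_pure (pure_power_exact resF _).
- exact: leqnn.
- apply/rowP => a.
  by rewrite !mxE /= pihomogX /= b2.
- by [].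
- move=> i iD; apply/(boundary0E _ _ resF) => e.
  rewrite !mxE -mpolyXD veronese_homX msuppX inE => /eqP ->.
  rewrite total_exponentD total_exponent1 bm; apply/pure_power_divides.
  rewrite inD in iD; have [j jd] := m_ann _ (mdeg_exponent i) iD.
  by exists j; rewrite ?ltn_ord // mnmDE.
- rewrite add0n => q qD c' c'e cyc.
  case: q qD c' c'e cyc => [|q] qD c' c'e cyc; first by rewrite -qD in D_gt0.
  (* Position [q.+1] computes [Tor_q] of the ideal, with [q < p]; the degree [2 + size D = q + 3]
     exceeds the linear bound [q + 2]. *)
  apply: (fiber_boundary_tor _ c'e cyc); apply: torF.
    by rewrite qD sizeD.
  by rewrite -qD ltz_nat; lia.
move=> cw; have /(boundary0E _ _ resF) : exists w,
    map_mx (kill (predC (mem D))) c =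
    map_mx (kill (predC (mem D))) (w *m augmented_diff F 0) by exists w.
(* Now [m] would have a divisor of degree [d] outside [D], which lists them all. *)
move=> /(_ m)[|i]; first by rewrite mxE veronese_homX bm msuppX inE.
by rewrite /= inD => /negP.
Qed.

End VeroneseSyzygy.

(** * Counting divisors of a fixed degree *)

Section Counting.
Variable n : nat.
Implicit Types (e : 'X_{1..n.+1}) (s : seq nat).

(** Variables past the end of [s] get exponent 0 from the default of [nth], so one list serves all
    large [n]. *)
Definition seq_monomial s : 'X_{1..n.+1} := [multinom nth 0 s j | j < n.+1].

Lemma le_seq_monomial s e i : (e <= seq_monomial s)%MM -> i < size s ->
  size s <= n.+1 -> e (inord i) <= nth 0 s i.
Proof.
move=> /mnm_lepP/(_ (inord i)) ei si sn.
by rewrite mnmE inordK // (leq_trans si) in ei.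
Qed.

Lemma mdeg_le_seq_monomial s e : (e <= seq_monomial s)%MM -> size s <= n.+1 ->
  mdeg e = \sum_(0 <= i < size s) e (inord i).
Proof.
move=> /mnm_lepP es sn; rewrite mdegE.
transitivity (\sum_(0 <= i < n.+1) e (inord i)).
  by rewrite big_mkord; apply: eq_bigr => i _; rewrite inord_val.
rewrite (big_cat_nat (n := size s)) //= [X in _ + X]big1_seq ?addn0 //.
move=> i; rewrite mem_index_iota => /andP[_ /andP[si in1]]; have := es (inord i).
by rewrite mnmE inordK // nth_default // leqn0 => /eqP.
Qed.

Lemma eq_le_seq_monomial s e e' :
  (e <= seq_monomial s)%MM -> (e' <= seq_monomial s)%MM ->
  (forall i, i < size s -> e (inord i) = e' (inord i)) -> e = e'.
Proof.
move=> /mnm_lepP es /mnm_lepP e's ee'; apply/mnmP => j.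
have [js|sj] := ltnP j (size s); first by have := ee' _ js; rewrite inord_val.
have := es j; have := e's j; rewrite mnmE nth_default // !leqn0.
by move=> /eqP -> /eqP ->.
Qed.

Lemma card_divisors_le d m (code : 'X_{1..n.+1} -> nat) (s : seq nat) :
  (forall e, mdeg e = d -> (e <= m)%MM -> code e \in s) ->
  (forall e e', mdeg e = d -> mdeg e' = d -> (e <= m)%MM -> (e' <= m)%MM ->
     code e = code e' -> e = e') ->
  #|[set i | (@exponent n d i <= m)%MM]| <= size s.
Proof.
move=> code_s code_inj; set A := [set i | _].
rewrite cardE -(size_map (code \o @exponent n d)); apply: uniq_leq_size.
  rewrite map_inj_in_uniq ?enum_uniq // => i j.
  rewrite !mem_enum !inE => im jm ij; apply: exponent_inj.
  by apply: code_inj ij => //; apply: mdeg_exponent.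
move=> x /mapP[i]; rewrite mem_enum inE => im ->.
exact/code_s/im/mdeg_exponent.
Qed.

End Counting.

(** * The two explicit monomials *)

Lemma plane_veronese_not_N2p (k : closedFieldType) (n d : nat) :
  2 <= n -> 3 <= d -> ~ N2p (veronese_ideal k n d) (3 * d - 2).
Proof.
move=> hn hd; pose s := [:: d.-1; d.-1; 2]; pose m := seq_monomial n s.
have sn : size s <= n.+1 by [].
have degE e : (e <= m)%MM ->
    [/\ mdeg e = e (inord 0) + e (inord 1) + e (inord 2), e (inord 0) <= d.-1,
        e (inord 1) <= d.-1 & e (inord 2) <= 2].
  move=> em; have le_e i : i < size s -> e (inord i) <= nth 0 s i.
    by move=> si; apply: le_seq_monomial em si sn.
  split; [|exact: (le_e 0)|exact: (le_e 1)|exact: (le_e 2)].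
  by rewrite (mdeg_le_seq_monomial em sn) !big_nat_recr //= big_geq.
have mE i : i < 3 -> m (inord i) = nth 0 s i.
  by move=> i3; rewrite mnmE inordK // (leq_trans i3).
(* For third exponent 0, 1, 2 the codes fill the intervals from 1 to [d - 1], from [d] to [2d - 1]
   and from [2d] to [3d - 2]. *)
pose code (e : 'X_{1..n.+1}) := e (inord 0) + e (inord 2) * d.
apply: (@veronese_not_N2p _ _ _ _ _ m); first by lia.
- have [-> _ _ _] := degE m (lepm_refl m).
  by rewrite !mE //=; lia.
- move=> j; rewrite mnmE.
  by case: (nat_of_ord j) => [|[|[|i]]] /=; rewrite ?nth_nil; lia.
- move=> e ed /degE[eE e0 e1 e2]; rewrite ed in eE.
  (* A divisor without [t_0] contains [t_1], because [t_2] contributes at most [2 < d]. *)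
  have [e0_gt0|e0_0] := posnP (e (inord 0)); last first.
    by exists (inord 0); rewrite mE //=; lia.
  by exists (inord 1); rewrite mE //=; lia.
rewrite -[leqRHS](size_iota 1).
apply: (card_divisors_le (code := code)).
- move=> e ed /degE[eE e0 e1 e2]; rewrite ed in eE.
  rewrite mem_iota /code; case: (e (inord 2)) eE e2 => [|[|[|c]]] // eE _; lia.
- move=> e e' ed ed' em em'.
  have [eE e0 e1 e2] := degE _ em; have [eE' e0' e1' e2'] := degE _ em'.
  rewrite ed in eE; rewrite ed' in eE'; rewrite /code => codeE.
  have e2E : e (inord 2) = e' (inord 2).
    (* Fixing the third exponents makes the codes linear in [d]. *)
    move: codeE eE eE' e2 e2'.
    by case: (e (inord 2)) (e' (inord 2)) => [|[|[|c]]] // [|[|[|c']]] //; lia.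
  rewrite e2E in eE codeE; move/addIn: codeE => e0E.
  apply: (eq_le_seq_monomial em em') => -[|[|[|i]]] //= _; lia.
Qed.

Lemma quadratic_veronese_not_N2p (k : closedFieldType) (n : nat) :
  3 <= n -> ~ N2p (veronese_ideal k n 2) 6.
Proof.
move=> hn; pose s := [:: 1; 1; 1; 1]; pose m := seq_monomial n s.
have sn : size s <= n.+1 by [].
have degE e : (e <= m)%MM ->
    [/\ mdeg e = e (inord 0) + e (inord 1) + e (inord 2) + e (inord 3)
      & [/\ e (inord 0) <= 1, e (inord 1) <= 1, e (inord 2) <= 1
          & e (inord 3) <= 1]].
  move=> em; have le_e i : i < size s -> e (inord i) <= nth 0 s i.
    by move=> si; apply: le_seq_monomial em si sn.
  split; last by split; [exact: (le_e 0)|exact: (le_e 1)|exact: (le_e 2)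
                        |exact: (le_e 3)].
  by rewrite (mdeg_le_seq_monomial em sn) !big_nat_recr //= big_geq.
have mE i : i < 4 -> m (inord i) = nth 0 s i.
  by move=> i3; rewrite mnmE inordK // (leq_trans i3).
(* Divisors are read as four binary digits; those of degree 2 have exactly two digits 1. *)
pose code (e : 'X_{1..n.+1}) :=
  e (inord 0) + 2 * e (inord 1) + 4 * e (inord 2) + 8 * e (inord 3).
apply: (@veronese_not_N2p _ _ _ _ _ m) => //.
- by have [-> _] := degE m (lepm_refl m); rewrite !mE.
- move=> j; rewrite mnmE.
  by case: (nat_of_ord j) => [|[|[|[|i]]]] //=; rewrite nth_nil.
- move=> e ed /degE[eE [e0 e1 e2 e3]]; rewrite ed in eE.
  (* A product of two distinct variables among four involves one of the first three; multiplying by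
     [m] squares it. *)
  have [e0_0|e0_gt0] := posnP (e (inord 0)); last first.
    by exists (inord 0); rewrite mE //=; lia.
  have [e1_0|e1_gt0] := posnP (e (inord 1)); last first.
    by exists (inord 1); rewrite mE //=; lia.
  by exists (inord 2); rewrite mE //=; lia.
apply: (card_divisors_le (code := code) (s := [:: 3; 5; 6; 9; 10; 12])).
- move=> e ed /degE[eE [e0 e1 e2 e3]]; rewrite ed in eE.
  rewrite !inE /code; lia.
- move=> e e' _ _ em em'.
  have [_ [e0 e1 e2 e3]] := degE _ em; have [_ [e0' e1' e2' e3']] := degE _ em'.
  rewrite /code => codeE.
  apply: (eq_le_seq_monomial em em') => -[|[|[|[|i]]]] //= _; lia.
Qed.

Theorem proposition3p2 (k : closedFieldType) (n d : nat)
    (hn : (2 <= n)%N) (hd : (2 <= d)%N) :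
  ((2 <= n)%N -> (3 <= d)%N -> ~ Np (veronese_ideal k n d) (3 * d - 2)) /\
  ((3 <= n)%N -> ~ Np (veronese_ideal k n 2) 6).
Proof.
split=> [n2 d3 [_]|n3 [_]]; first exact: plane_veronese_not_N2p.
exact: quadratic_veronese_not_N2p.
Qed.
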